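(* Suppose $\mathcal{B}$ is an $M$-bounded semi-normalized basis of a quasi-Banach space $\mathbb{X}$. Then $\mathcal{B}$ is almost greedy if and only if for every (respectively, for some) $\lambda>1$ there is a constant $C>0$ such that for every $m\in\mathbb{N}$, every $f\in\mathbb{X}$, and every greedy set $A$ of $f$ of cardinality $\lceil\lambda m\rceil$, $$\Vert f-S_A(f)\Vert\le C\sigma_m(f).$$ Moreover, if $\mathbb{X}$ is a $p$-Banach space ($0<p\le1$) and we denote the optimal constant in this inequality by $C_\lambda$, we have $$C_\lambda\le2^{1/p}A_pB_pC_{ag}^3\,\eta_p(C_{ag})\,\lceil(\lambda-1)^{-1}\rceil^{1/p}.$$
   Context: The scalar field $\mathbb{F}$ is $\mathbb{R}$ or $\mathbb{C}$. A quasi-norm satisfies the axioms of a norm except that the triangle inequality is replaced by $\Vert f+g\Vert\le\kappa(\Vert f\Vert+\Vert g\Vert)$ for some constant $\kappa\ge1$; a quasi-Banach space is a vector space complete for the topology of a quasi-norm. It is a $p$-Banach space if moreover $\Vert f+g\Vert^p\le\Vert f\Vert^p+\Vert g\Vert^p$ for all $f,g$. A basis of $\mathbb{X}$ is a sequence $\mathcal{B}=(\mathbf{x}_n)_{n=1}^\infty$ whose closed linear span is $\mathbb{X}$ and for which there is a (unique) sequence $(\mathbf{x}_n^* )_{n=1}^\infty$ in $\mathbb{X}^*$ with $\mathbf{x}_n^*(\mathbf{x}_k)=\delta_{k,n}$. It is $M$-bounded if $\sup_n\Vert\mathbf{x}_n\Vert\,\Vert\mathbf{x}_n^*\Vert<\infty$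 and semi-normalized if $0<\inf_n\Vert\mathbf{x}_n\Vert\le\sup_n\Vert\mathbf{x}_n\Vert<\infty$. For finite $A\subseteq\mathbb{N}$, $S_A(f)=\sum_{n\in A}\mathbf{x}_n^*(f)\mathbf{x}_n$. A set $A\subseteq\mathbb{N}$ is a greedy set of $f$ if $|\mathbf{x}_k^*(f)|\le|\mathbf{x}_n^*(f)|$ for all $n\in A$, $k\in\mathbb{N}\setminus A$. $\mathcal{B}$ is almost greedy if there is $C\ge1$ such that $\Vert f-S_A(f)\Vert\le C\Vert f-S_B(f)\Vert$ whenever $A$ is a finite greedy set of $f\in\mathbb{X}$ and $B\subseteq\mathbb{N}$ with $|B|\le|A|$; the smallest such $C$ is $C_{ag}$. For $f\in\mathbb{X}$ and $m\in\mathbb{N}$, $\sigma_m(f)=\inf\left\{\left\Vert f-\sum_{n\in B}b_n\mathbf{x}_n\right\Vert:|B|=m,\ b_n\in\mathbb{F}\right\}$. Put $A_p=(2^p-1)^{-1/p}$; $B_p=2^{1/p}A_p$ if $\mathbb{F}=\mathbb{R}$ and $B_p=4^{1/p}A_p$ if $\mathbb{F}=\mathbb{C}$; and $\eta_p(u)=\min_{0<t<1}(1-t^p)^{-1/p}\left(1-(1+A_p^{-1}u^{-1}t)^{-p}\right)^{-1/p}$ for $u>0$. *)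

(* Defs.v *)
From HB Require Import structures.
From mathcomp Require Import all_boot all_order all_algebra.
From mathcomp Require Import finmap.
From mathcomp Require Import complex.
From mathcomp Require Import all_classical all_reals all_analysis.
Set Implicit Arguments.
Unset Strict Implicit.
Unset Printing Implicit Defensive.
Import Order.TTheory GRing.Theory Num.Theory.
Import numFieldNormedType.Exports.
Local Open Scope classical_set_scope.
Local Open Scope ring_scope.

Variant field_kind := RealScalars | ComplexScalars.

Definition scalars (R : realType) (k : field_kind) : numFieldType :=
  match k with RealScalars => R | ComplexScalars => R[i] end.

(* The norm of the numFieldType R[i] takes its values in R[i]; this is the
   absolute value with values in R. *)
Definition modulus (R : realType) (k : field_kind) : scalars R k -> R :=
  match k return scalars R k -> R with
  | RealScalars => fun a => `|a|
  | ComplexScalars => fun a => ComplexField.Normc.normc a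
  end.

Section QuasiNorms.
Variables (R : realType) (k : field_kind) (X : lmodType (scalars R k)).
Implicit Types (N : X -> R) (f g : X).

Definition quasi_norm N : Prop :=
  [/\ forall f, 0 <= N f,
      forall f, N f = 0 -> f = 0,
      forall (a : scalars R k) f, N (a *: f) = modulus a * N f
    & exists2 kappa : R, 1 <= kappa &
        forall f g, N (f + g) <= kappa * (N f + N g)].

(* The topology of a quasi-norm is metrizable, so that completeness is
   sequential completeness. *)
Definition complete_for N : Prop :=
  forall u : nat -> X,
    (forall e : R, 0 < e -> exists n0 : nat, forall m n : nat,
       (n0 <= m)%N -> (n0 <= n)%N -> N (u m - u n) < e) ->
    exists l : X, N (u n - l) @[n --> \oo] --> 0.

Definition quasi_banach N : Prop := quasi_norm N /\ complete_for N.

Definition p_banach (p : R) N : Prop :=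
  quasi_banach N /\ forall f g, N (f + g) `^ p <= N f `^ p + N g `^ p.

Definition continuous_functional N (phi : {scalar X}) : Prop :=
  forall f (e : R), 0 < e -> exists2 d : R, 0 < d &
    forall g, N (g - f) < d -> modulus (phi g - phi f) < e.

(* For a continuous phi this set is nonempty and bounded, so the real-valued
   supremum is the genuine one. *)
Definition dual_norm N (phi : {scalar X}) : R :=
  sup [set modulus (phi f) | f in [set f | N f <= 1]].

End QuasiNorms.

Section Bases.
Variables (R : realType) (k : field_kind) (X : lmodType (scalars R k)).
Variable (N : X -> R).
(* The basis and its coordinate functionals; they are indexed from 0. *)
Variables (x : nat -> X) (xs : nat -> {scalar X}).

Definition lincomb (B : {fset nat}) (b : nat -> scalars R k) : X :=
  \sum_(n <- B) b n *: x n.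

(* The biorthogonal functionals are determined by x, because its linear span
   is dense; carrying them as a parameter avoids choosing them. *)
Definition is_basis : Prop :=
  [/\ forall f (e : R), 0 < e ->
        exists (B : {fset nat}) (b : nat -> scalars R k),
          N (f - lincomb B b) < e,
      forall n, continuous_functional N (xs n)
    & forall n j, xs n (x j) = (j == n)%:R].

Definition M_bounded : Prop :=
  has_ubound (range (fun n => N (x n) * dual_norm N (xs n))).

Definition semi_normalized : Prop :=
  0 < inf (range (fun n => N (x n))) /\ has_ubound (range (fun n => N (x n))).

Definition coord_proj (A : {fset nat}) (f : X) : X :=
  \sum_(n <- A) xs n f *: x n.

Definition greedy_set (f : X) (A : {fset nat}) : Prop :=
  forall n j : nat, n \in A -> j \notin A ->
    modulus (xs j f) <= modulus (xs n f).

Definition almost_greedy_const (C : R) : Prop :=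
  forall (f : X) (A B : {fset nat}), greedy_set f A -> (#|` B| <= #|` A|)%N ->
    N (f - coord_proj A f) <= C * N (f - coord_proj B f).

Definition almost_greedy : Prop :=
  exists2 C : R, 1 <= C & almost_greedy_const C.

(* Meaningful when the basis is almost greedy; the infimum is then attained. *)
Definition C_ag : R := inf [set C : R | 1 <= C /\ almost_greedy_const C].

Definition sigma_m (m : nat) (f : X) : R :=
  inf [set r : R | exists (B : {fset nat}) (b : nat -> scalars R k),
         #|` B| = m /\ r = N (f - lincomb B b)].

Definition greedy_sigma_const (lambda C : R) : Prop :=
  forall (m : nat) (f : X) (A : {fset nat}), (0 < m)%N ->
    greedy_set f A -> (#|` A|)%:Z = Num.ceil (lambda * m%:R) ->
    N (f - coord_proj A f) <= C * sigma_m m f.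

(* Extended-real valued, hence +oo when no constant works. *)
Definition C_lambda (lambda : R) : \bar R :=
  ereal_inf [set C%:E | C in [set C : R | 0 < C /\ greedy_sigma_const lambda C]].

End Bases.

Section Constants.
Variables (R : realType) (p : R).

Definition A_p : R := (2 `^ p - 1) `^ (- p^-1).

Definition B_p (k : field_kind) : R :=
  match k with
  | RealScalars => 2 `^ p^-1 * A_p
  | ComplexScalars => 4 `^ p^-1 * A_p
  end.

(* A minimum: the function is continuous on ]0, 1[ and blows up at both ends. *)
Definition eta_p (u : R) : R :=
  inf [set (1 - t `^ p) `^ (- p^-1) *
           (1 - (1 + A_p^-1 * u^-1 * t) `^ (- p)) `^ (- p^-1)
      | t in `]0, 1[ ].

End Constants.

(* Main.v *)
(* Almost greedy implies the bound: given |B| = m, put g = f - sum_B b_n x_n and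
   let E be a greedy set of g of cardinality |A| - m. Then B u E is a legitimate
   competitor of A, and f - S_(B u E) f = (g - S_E g) - S_(B \ E) g. The
   coordinates of g on B \ E are at most s = min_E |x_n^* g|. Take an indicator
   vector s 1_F with |F| = |E| and F so far away that g is negligible on F.
   Exchanging E with F in g + s 1_F bounds s 1_F by g, and exchanging F with a
   set D of at most |E| elements in s 1_F + S_D g bounds S_D g by s 1_F; then
   B \ E splits into ceil ((lambda - 1)^-1) such sets D. This avoids convexity
   and truncation estimates, and for a p-norm it yields the constant
   8^(1/p) C_ag^3 ceil ((lambda - 1)^-1)^(1/p), which is enough because A_p >= 1
   and both B_p and eta_p are at least 2^(1/p).

   Conversely, let h = f - S_B f and E = A \ B, a greedy set of h. The bound
   with m of the order of |E| gives h - S_E h = O(h), and S_(B \ A) f is O(h) by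
   the same double exchange, performed at cardinalities ceil (lambda m) and
   ceil (lambda ceil (lambda m)). *)

Require Import Defs.
From HB Require Import structures.
From mathcomp Require Import all_boot all_order all_algebra.
From mathcomp Require Import finmap.
From mathcomp Require Import complex.
From mathcomp Require Import all_classical all_reals all_analysis.
From mathcomp Require Import ring lra zify.
Import Order.TTheory GRing.Theory Num.Theory.
Import numFieldNormedType.Exports.
Local Open Scope classical_set_scope.
Local Open Scope ring_scope.

Set Implicit Arguments.
Unset Strict Implicit.
Unset Printing Implicit Defensive.

(** * Finite sets of indices *)

Lemma fset_fresh (Z : {fset nat}) (n : nat) :
  exists2 F : {fset nat}, #|` F| = n & forall j, j \in F -> j \notin Z.
Proof.
pose b := (\max_(i <- Z) i).+1.
exists [fset j in iota b n]%fset.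
  by rewrite card_fseq undup_id ?iota_uniq// size_iota.
move=> j; rewrite !inE mem_iota => /andP[bj _]; apply/negP => jZ.
by move: bj; rewrite ltnNge => /negP; apply; rewrite (leq_bigmax_seq j).
Qed.

Lemma fset_subset_card (A : {fset nat}) (n : nat) : (n <= #|` A|)%N ->
  exists2 B : {fset nat}, #|` B| = n & {subset B <= A}.
Proof.
move=> nA; exists [fset j in take n A]%fset.
  rewrite card_fseq undup_id ?take_uniq ?fset_uniq// size_takel//.
by move=> j; rewrite !inE => /mem_take.
Qed.

Lemma fset_argmin (R : realType) (w : nat -> R) (A : {fset nat}) :
  (0 < #|` A|)%N -> exists2 n, n \in A & forall j, j \in A -> w n <= w j.
Proof.
rewrite cardfs_gt0 => /fset0Pn[n0 n0A].
pose i0 : A := FSetSub n0A.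
case: (arg_minP (fun i : A => w (val i)) (erefl : predT i0)) => i _ imin.
exists (val i); first exact: valP.
by move=> j jA; exact: (imin (FSetSub jA)).
Qed.

(** * The real-valued modulus over both scalar fields *)

Section Modulus.
Variables (R : realType) (k : field_kind).
Implicit Types a b : scalars R k.

Lemma modulus_ge0 a : 0 <= modulus a.
Proof.
by case: k a => a /=; [exact: normr_ge0|case: a => u v; exact: sqrtr_ge0].
Qed.

Lemma modulus0 : modulus (0 : scalars R k) = 0.
Proof. by case: k => /=; [exact: normr0|exact: ComplexField.Normc.normc0]. Qed.

Lemma modulusM a b : modulus (a * b) = modulus a * modulus b.
Proof.
by case: k a b => a b /=; [exact: normrM|exact: ComplexField.Normc.normcM].
Qed.

Lemma modulusN1 : modulus (-1 : scalars R k) = 1.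
Proof.
case: k => /=; first by rewrite normrN1.
by rewrite sqrrN expr1n oppr0 expr0n addr0 sqrtr1.
Qed.

Definition real_scalar (s : R) : scalars R k :=
  match k return scalars R k with
  | RealScalars => s
  | ComplexScalars => s%:C%C
  end.

Lemma modulus_real (s : R) : 0 <= s -> modulus (real_scalar s) = s.
Proof.
rewrite /real_scalar; case: k => /= s0; first exact: ger0_norm.
by rewrite expr0n /= addr0 sqrtr_sqr ger0_norm.
Qed.

End Modulus.

(** * Finite combinations of basis vectors and coordinate projections *)

Section LinearCombinations.
Variables (R : realType) (k : field_kind) (X : lmodType (scalars R k)).
Variables (x : nat -> X) (xs : nat -> {scalar X}).
Implicit Types (A B : {fset nat}) (b c : nat -> scalars R k) (f g : X).

Lemma eq_lincomb A b c : {in A, b =1 c} -> lincomb x A b = lincomb x A c.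
Proof. by move=> bc; apply: eq_fbigr => n nA _; rewrite bc. Qed.

Lemma lincomb_ID A B b :
  lincomb x A b = lincomb x (A `&` B)%fset b + lincomb x (A `\` B)%fset b.
Proof.
rewrite /lincomb (big_fsetID _ (mem B)) /=; congr (_ + _); apply: eq_fbigl.
  by move=> n; rewrite !inE.
by move=> n; rewrite !inE andbC.
Qed.

(** Padding with zero coefficients lets a small support compete in [sigma_m], whose supports have
    exactly [m] elements. *)
Lemma lincomb_incl A B b : {subset A <= B} ->
  lincomb x B (fun n => if n \in A then b n else 0) = lincomb x A b.
Proof.
move=> AB; rewrite (lincomb_ID _ A).
have -> : (B `&` A)%fset = A by apply/fsetIidPr/fsubsetP.
rewrite [X in _ + X]big1_fset ?addr0; last first.
  by move=> n; rewrite inE => /andP[/negbTE-> _] _; rewrite scale0r.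
by apply: eq_lincomb => n /= ->.
Qed.

Lemma coord_projD A f g :
  coord_proj x xs A (f + g) = coord_proj x xs A f + coord_proj x xs A g.
Proof.
rewrite /coord_proj -big_split; apply: eq_bigr => n _ /=.
by rewrite raddfD scalerDl.
Qed.

Hypothesis biorth : forall n j, xs n (x j) = (j == n)%:R.

Lemma coord_lincomb n A b :
  xs n (lincomb x A b) = if n \in A then b n else 0.
Proof.
rewrite /lincomb raddf_sum /=.
under eq_bigr => j _ do rewrite linearZ /= biorth.
case: ifPn => nA.
  rewrite (big_fsetD1 n)//= eqxx mulr1 big1_fset ?addr0// => j.
  by rewrite !inE => /andP[/negbTE-> _] _; rewrite mulr0.
rewrite big1_fset// => j jA _; case: eqP => [jn|]; last by rewrite mulr0.
by rewrite -jn jA in nA.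
Qed.

Lemma coord_proj_lincomb A B b :
  coord_proj x xs A (lincomb x B b) = lincomb x (A `&` B)%fset b.
Proof.
rewrite -[LHS]/(lincomb x A (fun n => xs n (lincomb x B b))) (lincomb_ID _ B).
rewrite [X in _ + X]big1_fset ?addr0; last first.
  by move=> n; rewrite inE => /andP[/negbTE nB _] _;
    rewrite coord_lincomb nB scale0r.
by apply: eq_lincomb => n; rewrite inE coord_lincomb => /andP[_ ->].
Qed.

End LinearCombinations.

(** * Existence of greedy sets of prescribed cardinality *)

Section GreedySets.
Variables (R : realType) (k : field_kind) (X : lmodType (scalars R k)).
Variable xs : nat -> {scalar X}.
Implicit Types (f g : X) (A E F : {fset nat}).

(** Dropping an index of least modulus from a greedy set leaves a greedy set; this is repeated until
    [n] indices remain. *)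
Lemma greedy_subset f E n : greedy_set xs f E -> (n <= #|` E|)%N ->
  exists A, [/\ #|` A| = n, {subset A <= E} & greedy_set xs f A].
Proof.
move=> gE nE; have [d] := ubnP (#|` E| - n)%N.
elim: d E gE nE => // d IH E gE nE.
rewrite ltnS => dE; have [En|En] := eqVneq #|` E| n.
  by exists E; split.
have E_gt0 : (0 < #|` E|)%N by lia.
have [i iE imin] := fset_argmin (fun i => modulus (xs i f)) E_gt0.
have cardEi : #|` (E `\ i)%fset| = #|` E|.-1 by rewrite (cardfsD1 i E) iE.
have [|||A [An AE gA]] := IH (E `\ i)%fset; rewrite ?cardEi; [|lia|lia|].
  move=> a j; rewrite !inE => /andP[_ aE]; rewrite negb_and negbK.
  by case/orP => [/eqP->|jE]; [exact: imin|exact: gE].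
by exists A; split => // j /AE; rewrite !inE => /andP[].
Qed.

(** Indices are added one at a time. Since the coordinates tend to zero, their modulus attains a
    maximum off the current set; if they all vanish there, any fresh index will do. *)
Lemma greedy_exists f n :
  (forall e : R, 0 < e -> exists B : {fset nat},
     forall j, j \notin B -> modulus (xs j f) < e) ->
  exists2 A, #|` A| = n & greedy_set xs f A.
Proof.
move=> f_c0; elim: n => [|n [A An gA]].
  by exists fset0; [exact: cardfs0|move=> i j; rewrite inE].
suff [j jA jmax] : exists2 j, j \notin A & forall i, i \notin A ->
    modulus (xs i f) <= modulus (xs j f).
  exists (j |` A)%fset; first by rewrite cardfsU1 jA An.
  move=> a i; rewrite !inE negb_or => /orP[/eqP->|aA] /andP[_ iA].
    exact: jmax.
  exact: gA.
have [[j jA fj]|fA0] :=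
    pselect (exists2 j, j \notin A & 0 < modulus (xs j f)); last first.
  have [F F1 FA] := fset_fresh A 1.
  have /fset0Pn[j /FA jA] : F != fset0 by rewrite -cardfs_gt0 F1.
  exists j => // i iA; apply: le_trans (modulus_ge0 _).
  by rewrite leNgt; apply/negP => fi; apply: fA0; exists i.
have [B Blt] := f_c0 _ fj.
have jB : j \in B by apply: contraT => /Blt; rewrite ltxx.
have BA_gt0 : (0 < #|` (B `\` A)%fset|)%N.
  by rewrite cardfs_gt0; apply/fset0Pn; exists j; rewrite inE jA jB.
(* Off [B] every coordinate is smaller than that of [j], so a maximum over the finite set [B \ A] is
   a maximum off [A]. It is obtained as a minimum of the negated modulus. *)
have [i iBA imax] := fset_argmin (fun i => - modulus (xs i f)) BA_gt0.
move: iBA; rewrite inE => /andP[iA iB]; exists i => // a aA.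
have [aB|aB] := boolP (a \in B).
  by rewrite -lerN2; apply: imax; rewrite inE aA aB.
apply: (le_trans (ltW (Blt _ aB))).
by rewrite -lerN2; apply: imax; rewrite inE jA jB.
Qed.

End GreedySets.

(** * The double exchange and the direct estimate *)

Section QuasiNormedBasis.
Variables (R : realType) (k : field_kind) (X : lmodType (scalars R k)).
Variables (N : X -> R) (x : nat -> X) (xs : nat -> {scalar X}).
Variables (K : nat -> R) (cx cxs : R).
Implicit Types (f g h : X) (A B D E F : {fset nat}) (b c : nat -> scalars R k).

Hypothesis N_ge0 : forall f, 0 <= N f.
Hypothesis N_eq0 : forall f, N f = 0 -> f = 0.
Hypothesis NZ : forall a f, N (a *: f) = modulus a * N f.
(* K absorbs the quasi-triangle inequality: K q = q `^ p^-1 for a p-norm,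
   K q = (2 * kappa) ^+ q for a general quasi-norm. *)
Hypothesis N_sum : forall (u : nat -> X) q (M : R), 0 <= M ->
  (forall i, (i < q)%N -> N (u i) <= M) -> N (\sum_(i < q) u i) <= K q * M.
Hypothesis biorth : forall n j, xs n (x j) = (j == n)%:R.
Hypothesis dense : forall f (e : R), 0 < e ->
  exists B b, N (f - lincomb x B b) < e.
Hypothesis cx_gt0 : 0 < cx.
Hypothesis N_x : forall n, N (x n) <= cx.
Hypothesis cxs_gt0 : 0 < cxs.
Hypothesis N_xs : forall n f, modulus (xs n f) <= cxs * N f.

Local Notation S A f := (coord_proj x xs A f).
Local Notation abs n f := (modulus (xs n f)).

Lemma N0 : N 0 = 0.
Proof. by rewrite -(scale0r 0) NZ modulus0 mul0r. Qed.

Lemma NN f : N (- f) = N f.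
Proof. by rewrite -scaleN1r NZ modulusN1 mul1r. Qed.

Lemma N_add f g M : N f <= M -> N g <= M -> N (f + g) <= K 2 * M.
Proof.
move=> fM gM; have := @N_sum (fun i => if i == 0%N then f else g) 2 M.
rewrite !big_ord_recl big_ord0 /= addr0; apply; first exact: le_trans fM.
by case.
Qed.

Lemma N_sub f g M : N f <= M -> N g <= M -> N (f - g) <= K 2 * M.
Proof. by move=> fM gM; apply: N_add; rewrite ?NN. Qed.

Lemma K_ge0 q : 0 <= K q.
Proof.
have := @N_sum (fun=> 0) q 1 ler01; rewrite big1// N0 mulr1; apply.
by move=> *; exact: ler01.
Qed.

(** Biorthogonality makes [x 0] nonzero, so [N_sum] can be tested on a family whose only nonzero
    term is [x 0]. *)
Lemma K_ge1 q : (0 < q)%N -> 1 <= K q.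
Proof.
case: q => // q _.
have x0 : 0 < N (x 0%N).
  rewrite lt_neqAle N_ge0 andbT eq_sym; apply/eqP => /N_eq0 x0.
  by have /eqP := biorth 0 0; rewrite x0 raddf0 eq_sym oner_eq0.
rewrite -(ler_pM2r x0) mul1r.
have := @N_sum (fun i => if i == 0%N then x 0%N else 0) q.+1 (N (x 0%N)).
rewrite big_ord_recl /= big1// addr0; apply => // i _.
by case: ifP; rewrite ?N0.
Qed.

Lemma lincomb_pieces D c q m M : 0 <= M -> (#|` D| <= q * m)%N ->
  (forall F, (#|` F| <= m)%N -> {subset F <= D} -> N (lincomb x F c) <= M) ->
  N (lincomb x D c) <= K q * M.
Proof.
move=> M0 Dq FM.
(* The induction only cuts [D] into [q] pieces; [N_sum] is applied once to all of them, which gives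
   [K q] instead of a power of [K 2]. *)
suff [u uM ->] : exists2 u : nat -> X,
    (forall i, N (u i) <= M) & lincomb x D c = \sum_(i < q) u i.
  by apply: N_sum.
elim: q D Dq FM => [|q IH] D Dq FM.
  exists (fun=> 0); first by move=> _; rewrite N0.
  have -> : D = fset0 by apply: cardfs0_eq; lia.
  by rewrite big_ord0 /lincomb big_seq_fset0.
have [|F Fn FD] := @fset_subset_card D (minn m #|` D|); first exact: geq_minr.
have [||u uM Du] := IH (D `\` F)%fset.
- rewrite cardfsDS ?Fn; last exact/fsubsetP.
  by move: Dq; rewrite mulSn; lia.
- by move=> G Gm GD; apply: FM => // j /GD; rewrite inE => /andP[].
exists (fun i => if i is i'.+1 then u i' else lincomb x F c).
  case=> [|i] //=; apply: FM => //; rewrite Fn; exact: geq_minl.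
rewrite big_ord_recl /= -Du (lincomb_ID x D F).
by have /fsetIidPr-> : (F `<=` D)%fset by apply/fsubsetP.
Qed.

Lemma lincomb_le D c q s : 0 <= s -> (#|` D| <= q)%N ->
  (forall n, n \in D -> modulus (c n) <= s) ->
  N (lincomb x D c) <= K q * (s * cx).
Proof.
move=> s0 Dq cs; have sx0 : 0 <= s * cx by rewrite mulr_ge0// ltW.
apply: (@lincomb_pieces D c q 1); rewrite ?muln1//.
move=> F; rewrite leq_eqVlt => /orP[/cardfs1P[n ->] FD|F0 _].
  rewrite /lincomb big_seq_fset1 NZ ler_pM ?modulus_ge0//.
  by apply: cs; apply: FD; rewrite inE.
have -> : F = fset0 by apply: cardfs0_eq; lia.
by rewrite /lincomb big_seq_fset0 N0.
Qed.

(** Off the support of an approximating combination, the coordinates of [f] are those of the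
    remainder, which [N_xs] bounds uniformly. *)
Lemma coord_c0 f (e : R) : 0 < e ->
  exists B, forall n, n \notin B -> abs n f < e.
Proof.
move=> e0; have [|B [b Bb]] := dense f (e := e / cxs); first exact: divr_gt0.
exists B => n nB.
have -> : xs n f = xs n (f - lincomb x B b).
  by rewrite raddfB /= coord_lincomb// (negbTE nB) subr0.
apply: le_lt_trans (N_xs _ _) _.
by rewrite mulrC -ltr_pdivlMr.
Qed.

(* As the coordinates tend to zero, h has negligible coordinates on suitable
   sets of any cardinality. *)
Lemma fset_far h n (Z : {fset nat}) : exists F,
  [/\ #|` F| = n, forall j, j \in F -> j \notin Z & N (S F h) <= N h].
Proof.
have [Nh|Nh] := eqVneq (N h) 0.
  have [F Fn FZ] := fset_fresh Z n; exists F; split => //.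
  by rewrite (N_eq0 Nh) /coord_proj big1 ?N0// => i _; rewrite raddf0 scale0r.
have Nh0 : 0 < N h by rewrite lt_neqAle eq_sym Nh N_ge0.
(* The coordinate threshold is chosen so that [n] terms below it sum to at most [N h]; adding 1 to
   [K n] keeps the denominator positive. *)
have K0 : 0 < K n + 1 by rewrite ltr_wpDl// K_ge0.
have Kx0 : 0 < (K n + 1) * cx by rewrite mulr_gt0.
have e0 : 0 < N h / ((K n + 1) * cx) by exact: divr_gt0.
have [B Blt] := coord_c0 h e0.
have [F Fn FZ] := fset_fresh (B `|` Z)%fset n; exists F; split => //.
  by move=> j /FZ; rewrite inE negb_or => /andP[].
apply: (le_trans (@lincomb_le F _ n _ (ltW e0) _ _)); first by rewrite Fn.
  by move=> j /FZ; rewrite inE negb_or => /andP[/Blt/ltW].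
have -> : K n * (N h / ((K n + 1) * cx) * cx) = K n / (K n + 1) * N h.
  by field; rewrite !lt0r_neq0.
by rewrite ler_piMl// ler_pdivrMr// mul1r lerDl.
Qed.

(** A common weakening of the two properties to be compared: the almost greedy condition gives it
    with [a = m], the bound by [sigma_m] with [a] the ceiling of [lambda * m]. One exchange lemma
    then serves both implications. *)
Definition greedy_bound (a m : nat) (C : R) : Prop :=
  forall f A B, greedy_set xs f A -> #|` A| = a -> (#|` B| <= m)%N ->
    N (f - S A f) <= C * N (f - S B f).

(* The indicator of a far away set F serves as a go-between: it is dominated
   by h, since F can be exchanged with E, and it dominates lincomb x D c, since
   D can be exchanged with F. *)
Lemma lincomb_le_greedy a1 m1 C1 a2 m2 C2 h E D c s :
  0 <= C1 -> 0 <= C2 ->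
  greedy_bound a1 m1 C1 -> greedy_bound a2 m2 C2 -> (a2 <= m1)%N ->
  greedy_set xs h E -> #|` E| = a1 -> 0 <= s ->
  (forall n, n \in E -> s <= abs n h) ->
  (#|` D| <= m2)%N -> (forall n, n \in D -> modulus (c n) <= s) ->
  N (lincomb x D c) <= C2 * C1 * K 2 ^+ 2 * N h.
Proof.
move=> C10 C20 gb1 gb2 a2m1 gE Ea1 s0 sE Dm2 cs.
have [F [Fa2 FED NF]] := fset_far h a2 (E `|` D)%fset.
have FE j : j \in E -> j \in F = false.
  by move=> jE; apply/negP => /FED; rewrite inE jE.
have FD j : j \in D -> j \in F = false.
  by move=> jD; apply/negP => /FED; rewrite inE jD orbT.
have FIE : (F `&` E)%fset = fset0.
  by apply/fsetP => j; rewrite !inE; apply/andP => -[jF /FE]; rewrite jF.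
have EIF : (E `&` F)%fset = fset0 by rewrite fsetIC.
have FID : (F `&` D)%fset = fset0.
  by apply/fsetP => j; rewrite !inE; apply/andP => -[jF /FD]; rewrite jF.
have DIF : (D `&` F)%fset = fset0 by rewrite fsetIC.
have L0 d : lincomb x fset0 d = 0 by exact: big_seq_fset0.
pose v := lincomb x F (fun=> real_scalar k s).
(* Clearing [h] on [F] makes the coordinates of [h1 + v] on [F] exactly [s], at the cost of one
   factor [K 2]. *)
pose h1 := h - S F h.
have SF_h j : xs j (S F h) = if j \in F then xs j h else 0.
  by rewrite [S F h]/(lincomb x F (fun n => xs n h)) coord_lincomb.
have h1E j : xs j h1 = if j \in F then 0 else xs j h.
  by rewrite raddfB /= SF_h; case: ifP; rewrite ?subrr ?subr0.
have h1vE j : xs j (h1 + v) = if j \in F then real_scalar k s else xs j h.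
  rewrite (raddfD (xs j) h1 v) /= h1E coord_lincomb//.
  by case: ifP; rewrite ?add0r ?addr0.
have Nh1 : N h1 <= K 2 * N h by exact: N_sub.
have vE : N v <= C1 * K 2 ^+ 2 * N h.
  have SEv : S E v = 0 by rewrite coord_proj_lincomb// EIF L0.
  have SFh1 : S F h1 = 0.
    by rewrite /coord_proj big1_fset// => j jF _; rewrite h1E jF scale0r.
  have S0 f : S fset0 f = 0 by exact: big_seq_fset0.
  (* [E] is greedy for both [h1 + v] and [h1]. The competitors are [F], which leaves [h1], and the
     empty set, so each difference is at most [C1 * N h1]. *)
  have -> : v = (h1 + v - S E (h1 + v)) - (h1 - S E h1).
    by rewrite coord_projD SEv addr0 opprB addrA subrK addrAC subrr add0r.
  have -> : C1 * K 2 ^+ 2 * N h = K 2 * (C1 * (K 2 * N h)) by ring.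
  apply: N_sub.
    apply: le_trans (_ : C1 * N h1 <= _); last exact: ler_wpM2l.
    have {3}-> : h1 = h1 + v - S F (h1 + v).
      by rewrite coord_projD SFh1 coord_proj_lincomb// fsetIid add0r addrK.
    apply: gb1; rewrite ?Fa2//.
    move=> n j nE jE; rewrite !h1vE (FE n nE); case: ifP => _; last exact: gE.
    by rewrite modulus_real//; exact: sE.
  apply: le_trans (_ : C1 * N h1 <= _); last exact: ler_wpM2l.
  rewrite -[X in _ <= _ * N X]subr0 -(S0 h1); apply: gb1; rewrite ?cardfs0//.
  move=> n j nE jE; rewrite !h1E (FE n nE).
  case: ifP => _; last exact: gE.
  by rewrite modulus0 modulus_ge0.
(* [F] is greedy for [w]: the moduli are [s] on [F], at most [s] on [D], and zero elsewhere. The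
   competitor [D] leaves [v]. *)
pose w := v + lincomb x D c.
have SFw : S F w = v.
  by rewrite coord_projD !coord_proj_lincomb// fsetIid FID L0 addr0.
have SDw : S D w = lincomb x D c.
  by rewrite coord_projD !coord_proj_lincomb// fsetIid DIF L0 add0r.
have -> : lincomb x D c = w - S F w by rewrite SFw /w addrAC subrr add0r.
rewrite -2!mulrA; apply: le_trans (_ : C2 * N v <= _); last first.
  by rewrite ler_wpM2l// mulrA.
have -> : v = w - S D w by rewrite SDw /w addrK.
apply: gb2 => // n j nF jF.
rewrite 2!(raddfD _ v) /= !coord_lincomb// nF (negbTE jF).
have -> : (n \in D) = false.
  by apply/negP => /FD; rewrite nF.
rewrite addr0 add0r modulus_real//; case: ifP => [/cs//|_].
by rewrite modulus0.
Qed.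

Lemma coord_proj0 f : S fset0 f = 0.
Proof. exact: big_seq_fset0. Qed.

Lemma coord_proj_ID A B f : S A f = S (A `&` B)%fset f + S (A `\` B)%fset f.
Proof. exact: (lincomb_ID x A B (fun n => xs n f)). Qed.

Lemma almost_greedy_bound C m :
  almost_greedy_const N x xs C -> greedy_bound m m C.
Proof. by move=> agC f A B gA Am Bm; apply: agC => //; rewrite Am. Qed.

Lemma greedy_le_lincomb C q f A B b : 1 <= C -> almost_greedy_const N x xs C ->
  greedy_set xs f A -> (#|` B| < #|` A|)%N -> (0 < q)%N ->
  (#|` B| <= q * (#|` A| - #|` B|))%N ->
  N (f - S A f) <= K 2 ^+ 3 * K q * C ^+ 3 * N (f - lincomb x B b).
Proof.
move=> C1 agC gA BA q0 Bq; set g := f - lincomb x B b.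
have C0 : 0 <= C by exact: le_trans C1.
have [E En gE] := greedy_exists (#|` A| - #|` B|) (coord_c0 g).
have [|n0 n0E smin] := fset_argmin (fun i => abs i g) (A := E).
  by rewrite En subn_gt0.
have NE : N (g - S E g) <= C * N g.
  rewrite -[X in _ * N X]subr0 -(coord_proj0 g).
  by apply: agC; rewrite ?cardfs0.
have NBE : N (S (B `\` E)%fset g) <= K q * (C * C * K 2 ^+ 2 * N g).
  have M0 : 0 <= C * C * K 2 ^+ 2 * N g by rewrite !mulr_ge0// K_ge0.
  (* Each piece has at most [#|E|] elements lying off [E], so its coordinates are at most the least
     modulus [abs n0 g] on the greedy set [E]. *)
  apply: (@lincomb_pieces _ (fun n => xs n g) q #|` E|) => //.
    rewrite En (leq_trans _ Bq)//.
    by have := cardfsID E B; lia.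
  have gb : greedy_bound #|` E| #|` E| C by exact: almost_greedy_bound.
  move=> F Fm FD; apply: (@lincomb_le_greedy _ _ _ _ _ _ g E F _ (abs n0 g)
    C0 C0 gb gb) => //.
  - exact: modulus_ge0.
  - by move=> n /FD; rewrite inE => /andP[nE _]; exact: gE.
have BUE : (#|` (B `|` E)%fset| <= #|` A|)%N by rewrite cardfsU En; lia.
have fg : f - S (B `|` E)%fset f = (g - S E g) - S (B `\` E)%fset g.
  have -> : f = g + lincomb x B b by rewrite subrK.
  rewrite coord_projD coord_proj_lincomb//.
  have -> : ((B `|` E) `&` B = B)%fset by exact/fsetIidPr/fsubsetUl.
  rewrite opprD addrACA subrr addr0 (coord_proj_ID (B `|` E)%fset E).
  have -> : ((B `|` E) `&` E = E)%fset by exact/fsetIidPr/fsubsetUr.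
  by rewrite fsetDUl fsetDv fsetU0 opprD addrA addrAC.
apply: (le_trans (agC f A _ gA BUE)); rewrite fg.
(* The outer [C] compares [A] with [B] united with [E], the outer [K 2] splits the remainder in two,
   and the innermost bound is that of the double exchange. *)
have -> : K 2 ^+ 3 * K q * C ^+ 3 * N g =
    C * (K 2 * (K q * (C * C * K 2 ^+ 2 * N g))).
  by ring.
apply: ler_wpM2l => //; apply: N_sub => //; apply: (le_trans NE).
rewrite !mulrA ler_wpM2r//.
have K1 : 1 <= K q * C * K 2 ^+ 2.
  have CK : 1 <= K q * C by rewrite mulr_ege1// K_ge1.
  by rewrite mulr_ege1// exprn_ege1// K_ge1.
rewrite [leRHS](_ : _ = K q * C * K 2 ^+ 2 * C); last by ring.
by rewrite ler_peMl.
Qed.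

(** Fresh indices with zero coefficients enlarge [B] to cardinality [m] without changing the
    vector. *)
Lemma sigma_m_le m f B : (#|` B| <= m)%N -> sigma_m N x m f <= N (f - S B f).
Proof.
move=> Bm; have [F Fn FB] := fset_fresh B (m - #|` B|).
apply: ge_inf; first by exists 0 => _ [D [b [_ ->]]].
exists (B `|` F)%fset, (fun n => if n \in B then xs n f else 0); split.
  rewrite cardfsU; have -> : (B `&` F)%fset = fset0.
    by apply/fsetP => j; rewrite !inE; apply/andP => -[jB /FB]; rewrite jB.
  by rewrite cardfs0 Fn; lia.
by rewrite (lincomb_incl x (fun n => xs n f))// => j jB; rewrite inE jB.
Qed.

(** * From the bound by [sigma_m] to the almost greedy property *)

Section Converse.
Variables (lambda C : R).
Hypotheses (lambda_gt1 : 1 < lambda) (C_gt0 : 0 < C).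
Hypothesis greedyC : greedy_sigma_const N x xs lambda C.

Let c m := absz (Num.ceil (lambda * m%:R)).

Let cE m : (c m)%:Z = Num.ceil (lambda * m%:R).
Proof.
apply: gez0_abs; rewrite ceil_ge0; apply: lt_le_trans (_ : 0 <= _) => //.
by rewrite mulr_ge0// ltW// (lt_trans _ lambda_gt1).
Qed.

Let c_le m n : lambda * m%:R <= n%:R -> (c m <= n)%N.
Proof. by move=> mn; rewrite -lez_nat cE ceil_le_int. Qed.

Let c_ge m : lambda * m%:R <= (c m)%:R.
Proof. by have := ceil_ge (lambda * m%:R); rewrite -cE. Qed.

(** As [lambda <= c 1], the integer [c 1 * m] dominates [lambda * m]; this controls nested
    ceilings. *)
Let c_mul m : (c m <= c 1 * m)%N.
Proof.
apply: c_le; rewrite natrM ler_wpM2r//.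
by have := c_ge 1; rewrite mulr1.
Qed.

Let c1_gt0 : (0 < c 1)%N.
Proof.
rewrite -(ltr_nat R); apply: lt_le_trans (c_ge 1).
by rewrite mulr1 (lt_trans _ lambda_gt1).
Qed.

Let greedy_bound_c m : (0 < m)%N -> greedy_bound (c m) m C.
Proof.
move=> m0 f A B gA Ac Bm.
apply: (@le_trans _ _ (C * sigma_m N x m f)).
  by apply: greedyC => //; rewrite Ac cE.
by apply: ler_wpM2l; [exact: ltW|exact: sigma_m_le].
Qed.

(** The hypothesis reaches only the cardinalities [c m]. With [m] the integer part of
    [#|E| / lambda], a greedy subset of [c m] elements is compared with the empty set, and the at
    most [c 1] remaining terms are estimated one by one. *)
Let quasi_greedy h E : greedy_set xs h E ->
  N (h - S E h) <= K 2 * (C + 1 + K (c 1) * (cxs * cx)) * N h.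
Proof.
move=> gE; have l0 : 0 < lambda by exact: lt_trans lambda_gt1.
have q0 : 0 <= #|` E|%:R / lambda by rewrite divr_ge0// ltW.
pose m := Num.truncn (#|` E|%:R / lambda).
have /andP[mE Em] := truncn_itv q0; rewrite -/m in mE Em.
have cm : (c m <= #|` E|)%N by apply: c_le; rewrite mulrC -ler_pdivlMr.
have Ecm : (#|` E| <= c m + c 1)%N.
  rewrite -(ler_nat R) natrD; apply: le_trans (lerD (c_ge m) (c_ge 1)).
  by rewrite -mulrDr -natrD addn1 mulrC -ler_pdivrMr// ltW.
have [F [Fc FE gF]] := greedy_subset gE cm.
have NF : N (h - S F h) <= (C + 1) * N h.
  (* The hypothesis requires [0 < m]. For [m = 0] the subset is empty, and the summand 1 in [C + 1]
     suffices. *)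
  have [m0|m0] := posnP m.
    have F0 : F = fset0.
      apply: cardfs0_eq; apply/eqP; rewrite Fc -leqn0; apply: c_le.
      by rewrite m0 mulr0.
    by rewrite F0 coord_proj0 subr0 ler_peMl// lerDr ltW.
  apply: le_trans (_ : C * N h <= _); last by rewrite ler_wpM2r// lerDl.
  rewrite -[X in _ * N X]subr0 -(coord_proj0 h).
  by apply: greedy_bound_c m0 _ _ _ gF Fc _; rewrite cardfs0.
have NEF : N (S (E `\` F)%fset h) <= K (c 1) * (cxs * cx) * N h.
  have -> : K (c 1) * (cxs * cx) * N h = K (c 1) * (cxs * N h * cx) by ring.
  apply: (@lincomb_le _ (fun n => xs n h)) => //.
    by rewrite mulr_ge0// ltW.
  by rewrite cardfsDS ?Fc ?leq_subLR//; exact/fsubsetP.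
rewrite (coord_proj_ID E F).
have /fsetIidPr-> : (F `<=` E)%fset by exact/fsubsetP.
rewrite opprD addrA -mulrA mulrDl; apply: N_sub.
  by apply: (le_trans NF); rewrite lerDl !mulr_ge0// ?K_ge0// ltW.
by apply: (le_trans NEF); rewrite lerDr mulr_ge0// addr_ge0// ltW.
Qed.

Lemma almost_greedy_of_greedy_sigma : almost_greedy N x xs.
Proof.
(* Since [c (c m) <= q * m], taking [m = #|E| %/ q] leaves room in [E] for a greedy subset of
   [c (c m)] elements. *)
pose q := (c 1 * c 1)%N; have q0 : (0 < q)%N by rewrite muln_gt0 c1_gt0.
have C0 := ltW C_gt0; have cxs0 := ltW cxs_gt0; have cx0 := ltW cx_gt0.
pose C1 := K 2 * (C + 1 + K (c 1) * (cxs * cx)).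
pose C2 := K q * (cxs * cx) + K (2 * q) * (C * C * K 2 ^+ 2).
have C20 : 0 <= C2 by rewrite addr_ge0// !mulr_ge0// ?K_ge0.
have C11 : 1 <= C1.
  rewrite mulr_ege1// ?K_ge1// addrAC lerDr addr_ge0//.
  by rewrite !mulr_ge0// K_ge0.
exists (K 2 * (C1 + C2)).
  by rewrite mulr_ege1// ?K_ge1// (le_trans C11)// lerDl.
move=> f A B gA BA; set h := f - S B f.
pose E := (A `\` B)%fset; pose D := (B `\` A)%fset.
have hE n : xs n h = if n \in B then 0 else xs n f.
  rewrite raddfB /= [S B f]/(lincomb x B (fun n => xs n f)) coord_lincomb//.
  by case: ifP; rewrite ?subrr ?subr0.
have gE : greedy_set xs h E.
  move=> n j; rewrite !inE => /andP[nB nA]; rewrite negb_and negbK => jE.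
  rewrite !hE (negbTE nB); case: ifPn => [_|jB].
    by rewrite modulus0 modulus_ge0.
  by apply: gA => //; case/orP: jE => // jB'; rewrite jB' in jB.
have DE : (#|` D| <= #|` E|)%N.
  by rewrite -(leq_add2l #|` (A `&` B)%fset|) cardfsID fsetIC cardfsID.
(* The level [s] separates [E] from [D]: it is the least modulus on [E]. If [E] is empty, so is [D],
   and [s = 0] works. *)
have [s [s0 sh sE sD]] : exists s, [/\ 0 <= s, s <= cxs * N h,
    forall n, n \in E -> s <= abs n h & forall n, n \in D -> abs n f <= s].
  have [E0|] := posnP #|` E|.
    exists 0; split => //; first by rewrite mulr_ge0.
      by move=> n _; exact: modulus_ge0.
    have -> : D = fset0 by apply: cardfs0_eq; apply/eqP; rewrite -leqn0 -E0.
    by move=> n; rewrite inE.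
  move=> /(fset_argmin (fun i => abs i h))[n nE nmin].
  exists (abs n h); split => //; first exact: modulus_ge0.
  move: nE; rewrite !inE => /andP[nB nA] j; rewrite !inE => /andP[jA jB].
  by rewrite hE (negbTE nB); exact: gA.
have ND : N (lincomb x D (fun n => xs n f)) <= C2 * N h.
  pose m := (#|` E| %/ q)%N.
  have Em : (#|` E| < m.+1 * q)%N by rewrite ltn_ceil.
  have mE : (m * q <= #|` E|)%N by exact: leq_divM.
  (* If [m = 0], then [D] has fewer than [q] elements and is estimated termwise. Otherwise
     [(m + 1) * q <= 2 * q * m], so [2 * q] pieces of size [m] cover [D]. *)
  rewrite mulrDl; have [m0|m0] := posnP m.
    apply: (@le_trans _ _ (K q * (s * cx))).
      rewrite m0 mul1n in Em.
      by apply: lincomb_le => //; exact: leq_trans DE (ltnW Em).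
    apply: (@le_trans _ _ (K q * (cxs * cx) * N h)).
      by rewrite -mulrA ler_wpM2l ?K_ge0// mulrAC ler_wpM2r.
    by rewrite lerDl !mulr_ge0// ?K_ge0.
  apply: (@le_trans _ _ (K (2 * q) * (C * C * K 2 ^+ 2) * N h)); last first.
    by rewrite lerDr !mulr_ge0// ?K_ge0.
  rewrite -mulrA; apply: (@lincomb_pieces _ _ (2 * q) m).
  - by rewrite !mulr_ge0// ?K_ge0.
  - rewrite (leq_trans DE)// (leq_trans (ltnW Em))// mulSn -mulnA mul2n -addnn.
    by rewrite [(m * q)%N]mulnC leq_add2r leq_pmulr.
  have ccm : (c (c m) <= #|` E|)%N.
    apply: leq_trans mE; apply: (leq_trans (c_mul _)).
    by rewrite mulnC /q mulnA leq_mul2r; apply/orP; right; rewrite mulnC c_mul.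
  have [E' [E'c E'E gE']] := greedy_subset gE ccm.
  have cm0 : (0 < c m)%N.
    rewrite -(ltr_nat R); apply: lt_le_trans (c_ge m).
    by rewrite mulr_gt0 ?ltr0n// (lt_trans _ lambda_gt1).
  move=> F Fm FD; apply: (@lincomb_le_greedy _ _ _ _ _ _ h E' F _ s C0 C0
    (greedy_bound_c cm0) (greedy_bound_c m0)) => //.
    by move=> n /E'E /sE.
  by move=> n /FD /sD.
(* Removing [E] from [h] leaves [f] without its part on the union of [A] and [B]; adding back the
   part on [D] restores [f - S A f]. *)
have -> : f - S A f = (h - S E h) + lincomb x D (fun n => xs n f).
  have -> : S E h = S E f.
    apply: (eq_lincomb x) => n; rewrite inE => /andP[nB _].
    by rewrite hE (negbTE nB).
  rewrite -[lincomb x D _]/(S D f) /h (coord_proj_ID A B) (coord_proj_ID B A).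
  rewrite (fsetIC B A) -/E -/D !opprD !addrA.
  by rewrite [RHS]addrAC subrK.
rewrite -mulrA; apply: N_add; rewrite mulrDl.
  by apply: le_trans (quasi_greedy gE) _; rewrite lerDl mulr_ge0.
by apply: (le_trans ND); rewrite lerDr mulr_ge0// (le_trans ler01).
Qed.

End Converse.

End QuasiNormedBasis.

(** * Dual norms and sums in a quasi-normed space *)

Section QuasiNormFacts.
Variables (R : realType) (k : field_kind) (X : lmodType (scalars R k)).
Variable N : X -> R.
Hypothesis qN : quasi_norm N.

Lemma quasi_norm0 : N 0 = 0.
Proof. by case: qN => _ _ NZ _; rewrite -(scale0r 0) NZ modulus0 mul0r. Qed.

(** Besides rescaling [f] to the unit sphere, the supremum must be shown to be over a bounded set.
    Continuity at 0 with radius [d] bounds [phi] by [2 / d] on the unit ball, because scaling by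
    [d / 2] sends that ball strictly inside radius [d]. *)
Lemma dual_norm_le (phi : {scalar X}) f : continuous_functional N phi ->
  modulus (phi f) <= dual_norm N phi * N f.
Proof.
case: qN => N_ge0 N_eq0 NZ _ phi_cont.
have [Nf0|Nf0] := eqVneq (N f) 0.
  by rewrite Nf0 mulr0 (N_eq0 _ Nf0) raddf0 modulus0.
have Nf : 0 < N f by rewrite lt_neqAle eq_sym Nf0 N_ge0.
pose a : scalars R k := real_scalar k (N f)^-1.
have ha : modulus a = (N f)^-1 by rewrite modulus_real// invr_ge0 ltW.
have -> : modulus (phi f) = modulus (phi (a *: f)) * N f.
  by rewrite linearZ /= modulusM ha mulrAC mulVf// mul1r.
apply: ler_wpM2r => //.
have [d d0 phid] := phi_cont 0 1 ltr01.
apply: ub_le_sup; last first.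
  by exists (a *: f) => //=; rewrite NZ ha mulVf.
exists (2 / d) => _ [g /= Ng <-].
pose t : scalars R k := real_scalar k (d / 2).
have t0 : 0 < d / 2 by exact: divr_gt0.
have ht : modulus t = d / 2 by rewrite modulus_real// ltW.
have := phid (t *: g); rewrite subr0 NZ ht raddf0 subr0 linearZ /= modulusM ht.
have dg : d / 2 * N g < d.
  apply: le_lt_trans (_ : d / 2 < d); last by lra.
  by rewrite ler_piMr// ltW.
move=> /(_ dg); rewrite -ltr_pdivlMl// mulr1 invfM invrK mulrC => /ltW.
by rewrite mulrC.
Qed.

(** Dividing the M-boundedness estimate by the positive infimum of the norms [N (x n)] bounds the
    dual norms uniformly; the added 1 makes the constant positive. *)
Lemma coord_functional_bound (x : nat -> X) (xs : nat -> {scalar X}) :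
  (forall n, continuous_functional N (xs n)) ->
  M_bounded N x xs -> semi_normalized N x ->
  exists2 C : R, 0 < C & forall n f, modulus (xs n f) <= C * N f.
Proof.
case: qN => N_ge0 _ _ _ xs_cont [M MN] [infx _].
set c := inf _ in infx.
have cx n : c <= N (x n).
  by apply: ge_inf; [exists 0 => _ [j _ <-]|exists n].
exists (`|M| / c + 1); first by rewrite ltr_wpDl// divr_ge0// ltW.
move=> n f; apply: (le_trans (dual_norm_le f (xs_cont n))).
apply: ler_wpM2r => //.
have Mn : N (x n) * dual_norm N (xs n) <= M by apply: MN; exists n.
have [d0|d0] := leP (dual_norm N (xs n)) 0.
  by apply: (le_trans d0); rewrite addr_ge0// divr_ge0// ltW.
apply: le_trans (_ : `|M| / c <= _); last by rewrite lerDl.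
rewrite ler_pdivlMr// mulrC; apply: le_trans (ler_norm M); apply: le_trans Mn.
by rewrite ler_wpM2r// ltW.
Qed.

Lemma quasi_norm_sum : exists K : nat -> R,
  forall (u : nat -> X) q (M : R), 0 <= M ->
  (forall i, (i < q)%N -> N (u i) <= M) -> N (\sum_(i < q) u i) <= K q * M.
Proof.
case: (qN) => N_ge0 _ _ [kappa k1 N_add].
exists (fun q => (2 * kappa) ^+ q) => u q M M0.
elim: q => [_|q IH uM]; first by rewrite big_ord0 quasi_norm0 expr0 mul1r.
rewrite big_ord_recr /=; apply: (le_trans (N_add _ _)).
have -> : (2 * kappa) ^+ q.+1 * M = kappa * (2 * ((2 * kappa) ^+ q * M)).
  by rewrite exprS; ring.
rewrite ler_wpM2l//; first exact: le_trans k1.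
have uq : N (u q) <= (2 * kappa) ^+ q * M.
  apply: (le_trans (uM q (ltnSn q))); rewrite ler_peMl// exprn_ege1//; lra.
have := IH (fun i iq => uM i (ltnW iq)); lra.
Qed.

(** Adding [p]-th powers before taking the root gives the sharper factor required by the explicit
    constant. *)
Lemma p_norm_sum (p : R) : 0 < p ->
  (forall f g, N (f + g) `^ p <= N f `^ p + N g `^ p) ->
  forall (u : nat -> X) q (M : R), 0 <= M ->
  (forall i, (i < q)%N -> N (u i) <= M) ->
  N (\sum_(i < q) u i) <= q%:R `^ p^-1 * M.
Proof.
case: (qN) => N_ge0 _ _ _ p0 N_add u q M M0 uM.
have pn0 : p != 0 by rewrite gt_eqF.
suff : N (\sum_(i < q) u i) `^ p <= q%:R * M `^ p.
  move=> /(ge0_ler_powR (r := p^-1)); rewrite invr_ge0 ltW// !nnegrE.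
  rewrite powR_ge0 mulr_ge0 ?powR_ge0// => /(_ isT isT isT).
  by rewrite powRM ?powR_ge0// -!powRrM divff// !powRr1.
elim: q uM => [_|q IH uM].
  by rewrite big_ord0 quasi_norm0 powR0// mul0r.
rewrite big_ord_recr /= -natr1 mulrDl mul1r; apply: (le_trans (N_add _ _)).
apply: lerD; first by apply: IH => i iq; apply: uM; exact: ltnW.
by apply: ge0_ler_powR; rewrite ?nnegrE ?uM// ltW.
Qed.

End QuasiNormFacts.

(** * Lower bounds for [A_p], [B_p] and [eta_p] *)

Section ConstantBounds.
Variables (R : realType) (p : R).
Hypotheses (p_gt0 : 0 < p) (p_le1 : p <= 1).

Let two_powR_le2 : (2 : R) `^ p <= 2.
Proof. by apply: ler1_powR => //; rewrite ler1n. Qed.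

Let powR_1 (r : R) : 1 `^ r = 1.
Proof. by rewrite powR1. Qed.

Let powR_gt1 (a : R) : 1 < a -> 1 < a `^ p.
Proof.
move=> a1; rewrite -[ltLHS](powR_1 p); apply: gt0_ltr_powR => //.
  by rewrite nnegrE.
by rewrite nnegrE (le_trans ler01)// ltW.
Qed.

Let powRN_le (a b : R) : 0 < a -> 0 < b -> a * b <= 1 ->
  b `^ p^-1 <= a `^ (- p^-1).
Proof.
move=> a0 b0 ab; rewrite powRN -[leRHS]mul1r ler_pdivlMr ?powR_gt0//.
have [a_ge0 b_ge0] := (ltW a0, ltW b0).
rewrite -powRM// mulrC -[leRHS](powR_1 p^-1).
by apply: ge0_ler_powR; rewrite ?nnegrE ?invr_ge0 ?mulr_ge0// ltW.
Qed.

Lemma A_p_ge1 : 1 <= A_p p.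
Proof.
rewrite -[leLHS](powR_1 p^-1); apply: powRN_le => //.
  by rewrite subr_gt0 powR_gt1// ltr1n.
by rewrite mulr1 lerBlDr.
Qed.

Lemma B_p_ge k : 2 `^ p^-1 <= B_p p k.
Proof.
have p2 := powR_ge0 (2 : R) p^-1.
case: k => /=; first by rewrite ler_peMr// A_p_ge1.
apply: le_trans (_ : 4 `^ p^-1 <= _).
  by apply: ge0_ler_powR; rewrite ?nnegrE ?invr_ge0 ?ltW// ltr_nat.
by rewrite ler_peMr ?powR_ge0// A_p_ge1.
Qed.

(* Since [A_p^-1 * u^-1 * t <= 1], the second factor of the minimand is at
   least [(1 - 2 `^ (- p)) `^ (- p^-1)]. *)
Lemma eta_p_ge u : 1 <= u -> 2 `^ p^-1 <= eta_p p u.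
Proof.
move=> u1; apply: lb_le_inf.
  by apply: image_nonempty; exists 2^-1; rewrite /= in_itv /=; lra.
move=> y [t /=]; rewrite in_itv /= => /andP[t0 t1] <-.
set s := (A_p p)^-1 * u^-1 * t.
have A0 : 0 < A_p p by exact: lt_le_trans A_p_ge1.
have u0 : 0 < u by exact: lt_le_trans u1.
have s0 : 0 < s by rewrite !mulr_gt0// invr_gt0.
have s1 : s <= 1.
  rewrite /s -invfM mulrC ler_pdivrMr ?mulr_gt0// mul1r.
  by rewrite (le_trans (ltW t1))// mulr_ege1// A_p_ge1.
have tp : t `^ p < 1.
  by rewrite -[ltRHS](powR_1 p); apply: gt0_ltr_powR; rewrite ?nnegrE// ltW.
have tp0 : 0 < t `^ p by exact: powR_gt0.
have sp : (1 + s) `^ p <= 2.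
  apply: le_trans two_powR_le2.
  by apply: ge0_ler_powR; rewrite ?nnegrE ?(ltW p_gt0)//; lra.
have sp1 : 1 < (1 + s) `^ p.
  by rewrite powR_gt1// ltrDl.
have sp0 : 0 < (1 + s) `^ p by exact: lt_trans sp1.
have i1 : ((1 + s) `^ p)^-1 < 1 by rewrite invf_lt1.
have i2 : 2^-1 <= ((1 + s) `^ p)^-1 by rewrite lef_pV2 ?posrE.
rewrite [X in _ * (1 - X) `^ _]powRN -[leLHS]mul1r; apply: ler_pM => //.
- rewrite -[leLHS](powR_1 p^-1); apply: powRN_le; lra.
- apply: powRN_le; lra.
Qed.

End ConstantBounds.

(** * Optimal constants, cardinalities and the final assembly *)

Lemma C_ag_const (R : realType) (k : field_kind) (X : lmodType (scalars R k))
    (N : X -> R) (x : nat -> X) (xs : nat -> {scalar X}) :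
  (forall f, 0 <= N f) -> almost_greedy N x xs ->
  1 <= C_ag N x xs /\ almost_greedy_const N x xs (C_ag N x xs).
Proof.
move=> N_ge0 [C C1 agC].
have nonempty : [set C | 1 <= C /\ almost_greedy_const N x xs C] !=set0.
  by exists C.
split; first by apply: lb_le_inf => // D [].
move=> f A B gA BA; set M := N (f - coord_proj x xs B f).
(* For [M = 0] any admissible constant gives the claim; for [M > 0] the quotient by [M] is a lower
   bound of all admissible constants, hence of their infimum. *)
have [M0|M0] := eqVneq M 0.
  by have := agC f A B gA BA; rewrite -/M M0 !mulr0.
have Mgt0 : 0 < M by rewrite lt_neqAle eq_sym M0 N_ge0.
rewrite -ler_pdivrMr//; apply: lb_le_inf => // D [_ agD].
by rewrite ler_pdivrMr//; exact: agD.
Qed.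

(** From [(lambda - 1) * m <= a - m], division by [lambda - 1] shows how many blocks of [a - m]
    elements cover [m]. *)
Lemma ceil_card_bound (R : realType) (lambda : R) (m a : nat) :
  1 < lambda -> (0 < m)%N -> a%:Z = Num.ceil (lambda * m%:R) ->
  (m < a)%N /\ (m <= `|Num.ceil (lambda - 1)^-1| * (a - m))%N.
Proof.
move=> l1 m0 aE; have l0 : 0 < lambda - 1 by rewrite subr_gt0.
have la : lambda * m%:R <= a%:R by have := ceil_ge (lambda * m%:R); rewrite -aE.
have ma : (m < a)%N.
  by rewrite -(ltr_nat R) (lt_le_trans _ la)// ltr_pMl// ltr0n.
have c0 : 0 < Num.ceil (lambda - 1)^-1 by rewrite ceil_gt0 invr_gt0.
have qE : (`|Num.ceil (lambda - 1)^-1|%N)%:Z = Num.ceil (lambda - 1)^-1.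
  by rewrite gez0_abs// ltW.
split => //.
set q := absz _ in qE *.
have ql : (lambda - 1)^-1 <= q%:R.
  by have := ceil_ge (lambda - 1)^-1; rewrite -qE.
rewrite -(ler_nat R) natrM natrB ?(ltnW ma)//.
have ma1 : (lambda - 1) * m%:R <= a%:R - m%:R by lra.
rewrite -[leLHS](mulKf (lt0r_neq0 l0)); apply: ler_pM => //.
  by rewrite invr_ge0 ltW.
by rewrite mulr_ge0// ltW.
Qed.

Unset Implicit Arguments.

Theorem theorem7p2 (R : realType) (k : field_kind) (X : lmodType (scalars R k))
    (N : X -> R) (x : nat -> X) (xs : nat -> {scalar X})
    (hX : quasi_banach N) (hB : is_basis N x xs)
    (hM : M_bounded N x xs) (hs : semi_normalized N x) :
  [/\ almost_greedy N x xs <->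
        (forall lambda : R, 1 < lambda ->
           exists2 C : R, 0 < C & greedy_sigma_const N x xs lambda C),
      almost_greedy N x xs <->
        (exists2 lambda : R, 1 < lambda &
           exists2 C : R, 0 < C & greedy_sigma_const N x xs lambda C)
    & forall p : R, 0 < p -> p <= 1 -> p_banach p N ->
        almost_greedy N x xs ->
        forall lambda : R, 1 < lambda ->
          (C_lambda N x xs lambda <=
            (2 `^ p^-1 * A_p p * B_p p k * C_ag N x xs ^+ 3
              * eta_p p (C_ag N x xs)
              * (Num.ceil ((lambda - 1)^-1))%:~R `^ p^-1)%:E)%E].
Proof.
have [qN _] := hX; have [N_ge0 N_eq0 NZ _] := qN.
have [dense xs_cont biorth] := hB.
have [cxs cxs0 N_xs] := coord_functional_bound qN xs_cont hM hs.
have [cx cx0 N_x] : exists2 c : R, 0 < c & forall n, N (x n) <= c.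
  have [_ [c cN]] := hs; exists (`|c| + 1); first by rewrite ltr_wpDl.
  move=> n; apply: (@le_trans _ _ c); first by apply: cN; exists n.
  by rewrite (le_trans (ler_norm c))// lerDl.
(* Leaving [K] free allows one argument for both the qualitative statement and the explicit constant
   of a [p]-norm. *)
have direct (K : nat -> R) (lambda C D : R) :
    (forall (u : nat -> X) q (M : R), 0 <= M ->
       (forall i, (i < q)%N -> N (u i) <= M) ->
       N (\sum_(i < q) u i) <= K q * M) ->
    1 < lambda -> 1 <= C -> almost_greedy_const N x xs C ->
    K 2 ^+ 3 * K `|Num.ceil (lambda - 1)^-1|%N * C ^+ 3 <= D ->
    0 < D /\ greedy_sigma_const N x xs lambda D.
  move=> N_sum l1 C1 agC; set q := absz _ => KD.
  have K_ge1 := K_ge1 N_ge0 N_eq0 NZ N_sum biorth.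
  have q0 : (0 < q)%N.
    rewrite -ltz_nat gez0_abs ?ceil_gt0 ?invr_gt0 ?subr_gt0//.
    by rewrite ltW// ceil_gt0 invr_gt0 subr_gt0.
  have D0 : 0 < D.
    apply: lt_le_trans KD; rewrite (lt_le_trans ltr01)//.
    by rewrite !mulr_ege1// ?exprn_ege1// K_ge1.
  split=> // m f A m0 gA Am.
  have [mA mq] := ceil_card_bound l1 m0 Am.
  rewrite -ler_pdivrMl//; apply: lb_le_inf.
    have [F Fm _] := fset_fresh fset0 m.
    by exists (N (f - lincomb x F (fun=> 0))), F, (fun=> 0).
  move=> _ [B [b [Bm ->]]]; rewrite ler_pdivrMl//.
  apply: le_trans (_ : _ <= K 2 ^+ 3 * K q * C ^+ 3 * N (f - lincomb x B b)) _.
    by apply: (greedy_le_lincomb N_ge0 N_eq0 NZ N_sum biorth dense cx0 N_x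
      cxs0 N_xs); rewrite // Bm.
  by rewrite ler_wpM2r.
have [K N_sum] := quasi_norm_sum qN.
have agP : almost_greedy N x xs -> forall lambda : R, 1 < lambda ->
    exists2 C : R, 0 < C & greedy_sigma_const N x xs lambda C.
  move=> [C C1 agC] lambda l1.
  by have [] := direct K lambda C _ N_sum l1 C1 agC (lexx _); exists
    (K 2 ^+ 3 * K `|Num.ceil (lambda - 1)^-1|%N * C ^+ 3).
have agI (lambda : R) : 1 < lambda ->
    (exists2 C : R, 0 < C & greedy_sigma_const N x xs lambda C) ->
    almost_greedy N x xs.
  move=> l1 [C C0 gC].
  exact: (almost_greedy_of_greedy_sigma N_ge0 N_eq0 NZ N_sum biorth dense cx0
    N_x cxs0 N_xs l1 C0 gC).
split.
- split=> [|gs]; first exact: agP.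
  by apply: (agI 2); [|apply: gs]; rewrite ltr1n.
- split=> [ag|[lambda l1]]; last exact: agI.
  by exists 2; [|apply: agP]; rewrite ?ltr1n.
move=> p p0 p1 [_ N_p] ag lambda l1.
have [C1 agC] := C_ag_const N_ge0 ag; set C := C_ag N x xs in C1 agC *.
have p_sum := p_norm_sum qN p0 N_p.
apply: ereal_inf_lbound.
eexists; last reflexivity; apply: (direct _ _ _ _ p_sum l1 C1 agC).
have -> : (Num.ceil (lambda - 1)^-1)%:~R =
    `|Num.ceil (lambda - 1)^-1|%N%:R :> R.
  rewrite -[in LHS](@gez0_abs (Num.ceil _))// ltW//.
  by rewrite ceil_gt0 invr_gt0 subr_gt0.
set T := 2 `^ p^-1; set Q := (absz _)%:R `^ p^-1.
have T0 : 0 <= T by exact: powR_ge0.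
(* For a [p]-norm [K 2 = T]. Of the three factors [T], one is already present, and [B_p] and [eta_p]
   each supply another, while [A_p] is at least 1. *)
have TABE : T ^+ 3 <= T * A_p p * B_p p k * eta_p p C.
  have -> : T ^+ 3 = T * 1 * T * T by ring.
  by rewrite !ler_pM ?mulr_ge0 ?A_p_ge1 ?B_p_ge ?eta_p_ge.
have -> : T * A_p p * B_p p k * C ^+ 3 * eta_p p C * Q =
    T * A_p p * B_p p k * eta_p p C * Q * C ^+ 3 by ring.
by rewrite ler_wpM2r ?ler_wpM2r ?powR_ge0// exprn_ge0// (le_trans ler01).
Qed.
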